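(* Assume a Turing instability occurs at $\mu=0$, and consider the stripes on $\Omega_{\rm qh}=[0,4\pi/\kappa]\times[0,4\pi/(\sqrt3\ell)]$, $\kappa=k_c+\tilde\kappa$, $\ell=k_c+\tilde\ell$, $\tilde\ell\ne\tilde\kappa$, rescaled to $\Omega_3=[0,4\pi]\times[0,4\pi/\sqrt3]$, with periodic boundary conditions, scaling $(A,\alpha,\beta,\tilde\kappa,\tilde\ell)=(\varepsilon A',\varepsilon^2\alpha',\varepsilon\beta',\varepsilon\kappa',\varepsilon\ell')$, and velocity parameter $c=c(\mu)=-\lambda_\beta+\mathcal{O}(\varepsilon)$ of the stripes. The eigenvalues of the matrix $L_2^{\rm qh}$ (the subblock of the linearisation in stripes defined in the context) are $$\lambda_\pm=\varepsilon^2\left(A'^2(3k_0-q_2+8q_1)-\frac34\rho_\beta\beta'^2+\omega'\pm A'\left|\frac{2q}{\varepsilon}+p(\mu_1,\ell')\right|\right)+\mathcal{O}(\varepsilon^3),$$ where $A'=\sqrt{-(\alpha'+\rho_\beta\beta'^2+\rho_\kappa\kappa'^2)/\rho_{\rm nl}}+\mathcal{O}(\varepsilon)$ and $\omega':=(9\ell'+15\kappa')(\ell'-\kappa')\rho_\kappa/16$. Writing $\omega=\varepsilon^2\omega'$, the most unstable quasi-hexagonal perturbation with respect to $\tilde\ell$ occurs at $\tilde\ell=-\tilde\kappa/3$, for which $\omega=-\rho_\kappa\tilde\kappa^2\ge0$; and $\tilde\ell=\tilde\kappa$ (the exactly hexagonal case) gives $\omega=0$ and $\lambda_\pm=\lambda_{\rm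 hex}^\pm$, where $\lambda_{\rm hex}^\pm$ are the eigenvalues of the corresponding matrix $L_2^{\rm hex}$ of the exactly hexagonal domain.
   Context: System: $u_t=D\Delta u+Lu+\check\alpha Mu+\beta Bu_x+Q[u,u]+K[u,u,u]$, $u\in\mathbb{R}^2$, $\mathbf{x}=(x,y)\in\mathbb{R}^2$; $D=\mathrm{diag}(d_1,d_2)$, $d_i>0$; $L=\begin{pmatrix}a_1&a_2\\ a_3&a_4\end{pmatrix}$ and $M$ real $2\times2$ matrices; $Q$, $K$ symmetric bilinear/trilinear on $\mathbb{R}^2$, extended multilinearly to $\mathbb{C}^2$; $B=B(c)=\mathrm{diag}(1+c,c)$ with $c\in\mathbb{R}$. Turing instability with wavenumber $k_c>0$ at $\check\alpha=\beta=0$: with $\hat{\mathcal L}(k,\ell)=-(k^2+\ell^2)D+L+\check\alpha M+\mathrm{i}k\beta B$ and $d(\lambda,k,\ell)=\det(\hat{\mathcal L}(k,\ell)-\lambda\,\mathrm{Id})$, at $\check\alpha=\beta=0$: (1) all eigenvalues of $L$ have negative real part; (2) $d=0$ and $\mathrm{Re}\,\lambda\ge0$ iff $\lambda=0$ and $k^2+\ell^2=k_c^2$; (3) $\partial_\lambda d\ne0$ there. Set $\lambda_M:=-\partial_{\check\alpha}d/\partial_\lambda d$ (at $\check\alpha=0,\lambda=0$), assumed nonzero, and $\alpha:=\lambda_M\check\alpha$. Coefficients: $E_0,E_0^*\in\mathbb{R}^2$ span the kernels of $-k_c^2D+L$ and its transpose, $\langle E_0,E_0\rangle=\langle E_0,E_0^*\rangle=1$.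 $(-k_c^2D+L)^{-1}$ denotes the inverse from the range to the kernel of the projection $\langle\cdot,E_0^*\rangle E_0$. All coefficients are evaluated at $\mu=0$, where $c=-\lambda_\beta$, $\lambda_\beta=\frac{a_4-k_c^2d_2}{a_1+a_4-k_c^2(d_1+d_2)}$, so $\langle BE_0,E_0^*\rangle=0$. Define $Q_0=-2L^{-1}Q[\overline{E_0},E_0]$, $Q_2=-2(-4k_c^2D+L)^{-1}Q[E_0,E_0]$, $q_0=\langle Q[E_0,Q_0],E_0^*\rangle$, $q_2=\langle Q[\overline{E_0},Q_2],E_0^*\rangle$, $k_0=\langle K[E_0,E_0,\overline{E_0}],E_0^*\rangle$, $\rho_{\rm nl}=3k_0+2q_0+q_2$, $w_{A\beta}=k_c(-k_c^2D+L)^{-1}(\langle BE_0,E_0^*\rangle-B)E_0$, $w_{A\kappa}=2k_c(-k_c^2D+L)^{-1}DE_0$, $\rho_\beta=-k_c\langle Bw_{A\beta},E_0^*\rangle>0$, $\rho_\kappa=-2k_c\langle Dw_{A\kappa},E_0^*\rangle<0$. Standing assumption: $\rho_{\rm nl}<0$. Scaling: as in the claim, with $0<\varepsilon\ll1$ and primed quantities bounded; $\mu=(\alpha,\beta,\tilde\kappa)=\varepsilon\mu_1+\varepsilon^2\mu_2$, so $\mu_1$ carries $(\beta',\kappa')$. Stripes (known existence result): nontrivial small travelling waves constant in $y$, $2\pi/\kappa$-periodic in $x$, velocity $\beta c$ with $c=c(\mu)=-\lambda_\beta+\mathcal{O}(\varepsilon)$, leading-order profile $2\varepsilon A'E_0\cos(\kappa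 x)$ up to translation, in 1-to-1 correspondence with solutions $A=\varepsilon A'>0$ of $\varepsilon^2(\alpha'+\rho_\beta\beta'^2+\rho_\kappa\kappa'^2+\rho_{\rm nl}A'^2+\mathcal{O}(\varepsilon))=0$. The matrices: on $\Omega_3$ there is a six-dimensional centre manifold with coordinates $u_c=\sum_{j=\pm1,\pm2,\pm3}u_j\mathrm{e}^{\mathrm{i}\mathbf{k}_j\cdot\mathbf{x}}E_0$, $\mathbf{k}_1=(1,0)$, $\mathbf{k}_2=(-1/2,\sqrt3/2)$, $\mathbf{k}_3=-(1/2,\sqrt3/2)$, $\mathbf{k}_{-j}=-\mathbf{k}_j$. The linearisation of the reduced ODE in stripes in index ordering $(1,-1,2,-3,3,-2)$ is $\mathrm{diag}(L_1,L_2^{\rm qh},L_2^{\rm qh})+\mathcal{O}(\varepsilon^3)$ with $L_1=A^2\begin{pmatrix}\rho_{\rm nl}&\rho_{\rm nl}\\ \rho_{\rm nl}&\rho_{\rm nl}\end{pmatrix}$ and $$L_2^{\rm qh}=\varepsilon^2\begin{pmatrix}\lambda'_{\mu,\tilde\ell}+A'^2\eta&2A'\frac{q}{\varepsilon}+A'p(\mu_1,\ell')\\2A'\frac{q}{\varepsilon}+A'\overline{p(\mu_1,\ell')}&\lambda'_{\mu,\tilde\ell}+A'^2\eta\end{pmatrix},$$ $\lambda'_{\mu,\tilde\ell}=\alpha'+\frac14\rho_\beta\beta'^2+\frac{\rho_\kappa}{16}(\kappa'+3\ell')^2+\mathcal{O}(\varepsilon)$ (real), $q=\langle Q[E_0,E_0],E_0^*\rangle$,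 $\eta=6k_0+2q_0+8q_1$, $q_1=\langle Q[E_0,Q_1],E_0^*\rangle$, $Q_1=(-k_c^2D+L)^{-1}(\langle Q[E_0,E_0],E_0^*\rangle E_0-Q[E_0,E_0])$, $p(\mu_1,\ell')=\langle Q[\mathrm{i}\beta'w_{A\beta}+(\frac52\kappa'+\frac32\ell')w_{A\kappa},E_0]-(\mathrm{i}\beta'k_cB+(\kappa'+3\ell')k_cD)Q_1,E_0^*\rangle$. For the exactly hexagonal domain $[0,4\pi/\kappa]\times[0,4\pi/(\sqrt3\kappa)]$ the corresponding block $L_2^{\rm hex}$ has the same form with $\lambda'_{\mu,\tilde\ell}$ replaced by $\alpha'+\frac14\rho_\beta\beta'^2+\rho_\kappa\kappa'^2+\mathcal{O}(\varepsilon)$ and $p(\mu_1,\ell')$ replaced by $p(\mu_1)=\langle Q[\mathrm{i}\beta'w_{A\beta}+4\kappa'w_{A\kappa},E_0],E_0^*\rangle+\langle(-4\kappa'k_cD-\mathrm{i}\beta'k_cB)Q_1,E_0^*\rangle$; its eigenvalues are $\lambda_{\rm hex}^\pm=\varepsilon^2\big(A'^2(3k_0-q_2+8q_1)-\frac34\rho_\beta\beta'^2\pm A'|\frac{2q}{\varepsilon}+p(\mu_1)|\big)+\mathcal{O}(\varepsilon^3)$.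
   Formalization: ''Most unstable at ℓ̃=−κ̃/3'' is proved for ω, and for the leading part of λ± with |2q/ε+p| held fixed, since p also depends on ℓ' and λ+ itself need not peak there; the expansion of A' assumes the leading radicand bounded away from 0, as it fails where the radicand vanishes. *)

(* Defs.v *)
From HB Require Import structures.
From mathcomp Require Import all_boot all_order all_algebra.
From mathcomp Require Import complex.
From mathcomp Require Import all_classical all_reals all_analysis.

Set Implicit Arguments.
Unset Strict Implicit.
Unset Printing Implicit Defensive.

Import Order.TTheory GRing.Theory Num.Theory.
Import numFieldNormedType.Exports.

Local Open Scope classical_set_scope.
Local Open Scope complex_scope.
Local Open Scope ring_scope.

Section Vectors.
Context {R : realType}.
Implicit Types (u v : 'cV[R]_2) (A : 'M[R]_2).

Definition mx22 (S : Type) (a b c d : S) : 'M[S]_2 :=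
  \matrix_(i, j) if i == 0 then (if j == 0 then a else b)
                 else (if j == 0 then c else d).

Definition vdot u v : R := \sum_i u i 0 * v i 0.

(* The pairing of a complex vector with a real one, linear in the former. *)
Definition vdotC (z : 'cV[R[i]]_2) v : R[i] := \sum_i z i 0 * (v i 0)%:C.

Definition mxC m n (A : 'M[R]_(m, n)) : 'M[R[i]]_(m, n) :=
  map_mx (real_complex R) A.

(* Eigenvalues of a 2x2 matrix, listed with algebraic multiplicity. *)
Definition eigenvalues2 (A : 'M[R[i]]_2) (x y : R[i]) : Prop :=
  (forall z, eigenvalue A z <-> z = x \/ z = y) /\
  char_poly A = ('X - x%:P) * ('X - y%:P).

End Vectors.

(* The system u_t = D Lap u + L u + a M u + b B u_x + Q[u,u] + K[u,u,u],
   where D = diag(d1, d2). *)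
Record system (R : realType) := System {
  d1 : R;
  d2 : R;
  sysL : 'M[R]_2;
  sysM : 'M[R]_2;
  sysQ : 'cV[R]_2 -> 'cV[R]_2 -> 'cV[R]_2;
  sysK : 'cV[R]_2 -> 'cV[R]_2 -> 'cV[R]_2 -> 'cV[R]_2;
  d1_gt0 : 0 < d1;
  d2_gt0 : 0 < d2;
  sysQ_sym : forall u v, sysQ u v = sysQ v u;
  sysQ_lin : forall u, linear (sysQ u);
  sysK_sym12 : forall u v w, sysK u v w = sysK v u w;
  sysK_sym23 : forall u v w, sysK u v w = sysK u w v;
  sysK_lin : forall u v, linear (sysK u v) }.

Section System.
Context {R : realType} (S : system R).

Definition sysD : 'M[R]_2 := mx22 (d1 S) 0 0 (d2 S).
Definition sysB (c : R) : 'M[R]_2 := mx22 (1 + c) 0 0 c.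

(* The C-bilinear extension of Q. *)
Definition sysQC (z w : 'cV[R[i]]_2) : 'cV[R[i]]_2 :=
  let re := map_mx (@complex.Re R) in let im := map_mx (@complex.Im R) in
  mxC (sysQ S (re z) (re w) - sysQ S (im z) (im w)) +
  'i%C *: mxC (sysQ S (re z) (im w) + sysQ S (im z) (re w)).

(* The parameter a multiplying M is taken complex, as is lambda, so that the
   partial derivatives of d below are derivatives of functions R[i] -> R[i]. *)
Definition Lhat (a : R[i]) (b c k l : R) : 'M[R[i]]_2 :=
  mxC (- (k ^+ 2 + l ^+ 2) *: sysD + sysL S) + a *: mxC (sysM S) +
  ('i%C * (k * b)%:C) *: mxC (sysB c).

Definition disp (a : R[i]) (b c : R) (lam : R[i]) (k l : R) : R[i] :=
  \det (Lhat a b c k l - lam%:M).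

End System.

Record critical_data (R : realType) := CriticalData {
  sys :> system R;
  kc : R;
  E0 : 'cV[R]_2;
  E0s : 'cV[R]_2 }.

Section Critical.
Context {R : realType} (T : critical_data R).
Local Notation D := (sysD T).
Local Notation L := (sysL T).
Local Notation Q := (sysQ T).
Local Notation K := (sysK T).
Local Notation kc := (kc T).
Local Notation E0 := (E0 T).
Local Notation E0s := (E0s T).

Definition lambda_beta : R :=
  (L 1 1 - kc ^+ 2 * d2 T) / (L 0 0 + L 1 1 - kc ^+ 2 * (d1 T + d2 T)).

(* B at criticality, where c = - lambda_beta. *)
Definition B0 : 'M[R]_2 := sysB (- lambda_beta).

(* d at a = b = 0 (where it does not depend on c), and its partial derivatives
   with respect to lambda and a at a = b = 0, lambda = 0. *)
Definition disp0 (lam : R[i]) (k l : R) : R[i] :=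
  disp T 0 0 (- lambda_beta) lam k l.
Definition d_lambda (k l : R) : R[i] :=
  derive1 (fun lam : R[i] => disp0 lam k l : R[i]^o) 0.
Definition d_alpha (k l : R) : R[i] :=
  derive1 (fun a : R[i] => disp T a 0 (- lambda_beta) 0 k l : R[i]^o) 0.

(* At b = 0, d depends on (k, l) only through k^2 + l^2, so that (kc, 0)
   represents the whole critical circle. *)
Definition lambdaM : R[i] := - d_alpha kc 0 / d_lambda kc 0.

Definition turing_instability : Prop :=
  [/\ 0 < kc,
      forall z : R[i], eigenvalue (mxC L) z -> complex.Re z < 0,
      forall (lam : R[i]) (k l : R),
        (disp0 lam k l = 0 /\ 0 <= complex.Re lam) <->
        (lam = 0 /\ k ^+ 2 + l ^+ 2 = kc ^+ 2),
      forall k l : R, k ^+ 2 + l ^+ 2 = kc ^+ 2 -> d_lambda k l != 0 &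
      lambdaM != 0].

Definition Lcrit : 'M[R]_2 := - kc ^+ 2 *: D + L.

Definition critical_vectors : Prop :=
  [/\ forall v, Lcrit *m v = 0 <-> exists s : R, v = s *: E0,
      forall v, Lcrit^T *m v = 0 <-> exists s : R, v = s *: E0s,
      vdot E0 E0 = 1 & vdot E0 E0s = 1].

(* The inverse of Lcrit from its range to the kernel of <., E0s> E0;
   the value is junk outside the range. *)
Definition Lcrit_inv (w : 'cV[R]_2) : 'cV[R]_2 :=
  xget 0 [set v | Lcrit *m v = w /\ vdot v E0s = 0].

(* E0 is real, hence equal to its complex conjugate. *)
Definition Q0 : 'cV[R]_2 := - 2 *: (invmx L *m Q E0 E0).
Definition Q2 : 'cV[R]_2 :=
  - 2 *: (invmx (- (4 * kc ^+ 2) *: D + L) *m Q E0 E0).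
Definition q : R := vdot (Q E0 E0) E0s.
Definition Q1 : 'cV[R]_2 := Lcrit_inv (q *: E0 - Q E0 E0).
Definition q0 : R := vdot (Q E0 Q0) E0s.
Definition q1 : R := vdot (Q E0 Q1) E0s.
Definition q2 : R := vdot (Q E0 Q2) E0s.
Definition k0 : R := vdot (K E0 E0 E0) E0s.
Definition rho_nl : R := 3 * k0 + 2 * q0 + q2.
Definition eta : R := 6 * k0 + 2 * q0 + 8 * q1.

Definition wAbeta : 'cV[R]_2 :=
  kc *: Lcrit_inv (vdot (B0 *m E0) E0s *: E0 - B0 *m E0).
Definition wAkappa : 'cV[R]_2 := (2 * kc) *: Lcrit_inv (D *m E0).
Definition rho_beta : R := - kc * vdot (B0 *m wAbeta) E0s.
Definition rho_kappa : R := - (2 * kc) * vdot (D *m wAkappa) E0s.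

(* A stripe: a nontrivial steady state phi(x), constant in y and
   2 pi / kappa - periodic, of the system with B = B(c), that is, in the frame
   comoving with velocity b c. *)
Definition is_stripe (a b c kappa : R) (phi : R -> 'cV[R]_2) : Prop :=
  [/\ exists x, phi x != 0,
      forall x, phi (x + 2 * pi / kappa) = phi x,
      forall x, derivable phi x 1 /\ derivable (derive1 phi) x 1 &
      forall x, D *m derive1n 2 phi x + L *m phi x + a *: (sysM T *m phi x) +
        b *: (sysB c *m derive1 phi x) + Q (phi x) (phi x) +
        K (phi x) (phi x) (phi x) = 0].

Definition amplitude_sq (al be ka : R) : R :=
  - (al + rho_beta * be ^+ 2 + rho_kappa * ka ^+ 2) / rho_nl.

(* Small stripes along a curve of parameters: al, be, ka, A are the primed
   (scaled) parameters and amplitude as bounded functions of e > 0, so that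
   O(e^n) along every such curve amounts to O(e^n) uniformly for bounded
   primed quantities.  ac is the coefficient of M, with alpha = lambdaM * ac;
   x0 is the translation of the profile; rA is the O(e) term of the
   bifurcation equation. *)
Definition stripe_family (al be ka A ac c x0 : R -> R)
    (phi : R -> R -> 'cV[R]_2) : Prop :=
  [/\ [/\ bounded_near al 0^'+, bounded_near be 0^'+,
          bounded_near ka 0^'+ & bounded_near A 0^'+],
      (fun e => c e + lambda_beta) =O_ (0^'+) (fun e => e),
      \forall e \near 0^'+,
        [/\ 0 < A e,
            (e ^+ 2 * al e)%:C = lambdaM * (ac e)%:C &
            is_stripe (ac e) (e * be e) (c e) (kc + e * ka e) (phi e)],
      (exists C : R, \forall e \near 0^'+, forall x,
        `|phi e x - (2 * (e * A e) * cos ((kc + e * ka e) * (x - x0 e))) *: E0|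
          <= C * e ^+ 2) &
      exists2 rA : R -> R, rA =O_ (0^'+) (fun e => e) &
        \forall e \near 0^'+,
          e ^+ 2 * (al e + rho_beta * be e ^+ 2 + rho_kappa * ka e ^+ 2 +
                    rho_nl * A e ^+ 2 + rA e) = 0].

Definition offdiag (e : R) (p : R[i]) : R[i] := (2 * q / e)%:C + p.

(* The blocks of the linearisation in a stripe; lam is lambda'. *)
Definition block (e A lam : R) (p : R[i]) : 'M[R[i]]_2 :=
  (e ^+ 2)%:C *:
    mx22 (lam + A ^+ 2 * eta)%:C (A%:C * offdiag e p)
         (A%:C * offdiag e (p^*)%C) (lam + A ^+ 2 * eta)%:C.

Definition p_qh (be ka l : R) : R[i] :=
  vdotC (sysQC T ('i%C *: mxC (be *: wAbeta) +
                  mxC ((5 / 2 * ka + 3 / 2 * l) *: wAkappa)) (mxC E0) -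
         ('i%C *: mxC ((be * kc) *: (B0 *m Q1)) +
          mxC (((ka + 3 * l) * kc) *: (D *m Q1)))) E0s.

Definition p_hex (be ka : R) : R[i] :=
  vdotC (sysQC T ('i%C *: mxC (be *: wAbeta) + mxC ((4 * ka) *: wAkappa))
               (mxC E0)) E0s +
  vdotC (mxC (- (4 * ka * kc) *: (D *m Q1)) -
         'i%C *: mxC ((be * kc) *: (B0 *m Q1))) E0s.

(* r is the O(e) term in lambda'.  On [0, 4 pi / kappa] x
   [0, 4 pi / (sqrt 3 l)] the oblique critical modes have wave vectors
   (kappa / 2, sqrt 3 l / 2) up to signs: the first component gives
   rho_beta / 4, and the length kc + e (ka + 3 l') / 4 + O(e^2) gives
   rho_kappa / 16.  On the hexagonal domain the length is kappa. *)
Definition L2qh (e al be ka l A r : R) : 'M[R[i]]_2 :=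
  block e A (al + rho_beta / 4 * be ^+ 2 +
             rho_kappa / 16 * (ka + 3 * l) ^+ 2 + r) (p_qh be ka l).
Definition L2hex (e al be ka A r : R) : 'M[R[i]]_2 :=
  block e A (al + rho_beta / 4 * be ^+ 2 + rho_kappa * ka ^+ 2 + r)
        (p_hex be ka).

Definition omega' (ka l : R) : R :=
  (9 * l + 15 * ka) * (l - ka) * rho_kappa / 16.

(* omega = e^2 omega', in terms of the unscaled kt = e ka and lt = e l. *)
Definition omega (e kt lt : R) : R := e ^+ 2 * omega' (kt / e) (lt / e).

(* The leading part of an eigenvalue, with sg = 1 or -1, w = omega' and m the
   modulus of 2 q / e + p. *)
Definition lead (sg e be A w m : R) : R :=
  e ^+ 2 * (A ^+ 2 * (3 * k0 - q2 + 8 * q1) - 3 / 4 * rho_beta * be ^+ 2 + w +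
            sg * (A * m)).

Definition lead_qh (sg e be ka l A : R) : R :=
  lead sg e be A (omega' ka l) (complex.Re `|offdiag e (p_qh be ka l)|).
Definition lead_hex (sg e be ka A : R) : R :=
  lead sg e be A 0 (complex.Re `|offdiag e (p_hex be ka)|).

End Critical.

(* Main.v *)
(* The block is [s Id] plus an off-diagonal part with conjugate entries [A z]
   and [A z^*], so its eigenvalues are exactly [s +- A |z|]; eliminating [al]
   by the bifurcation equation of the stripes gives the leading part up to an
   error of [e ^+ 2] times the difference of the two O(e) terms.

   The optimum in the transverse wavenumber needs [rho_kappa < 0].  Stability
   of [L] and criticality on the circle of radius [kc] only make
   [det (- s D + L) = d1 d2 (s - kc ^+ 2) ^+ 2] and [tr Lcrit < 0].  Moreover
   [Lcrit = tr Lcrit (Id - E0 E0s^T)], so that [Lcrit_inv] is division by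
   [tr Lcrit], and Cayley-Hamilton for [D] yields
   [rho_kappa = 4 kc ^+ 2 d1 d2 / tr Lcrit]. *)

Require Import Defs.
From HB Require Import structures.
From mathcomp Require Import all_boot all_order all_algebra.
From mathcomp Require Import complex ring lra.
From mathcomp Require Import all_classical all_reals all_analysis.

Set Implicit Arguments.
Unset Strict Implicit.
Unset Printing Implicit Defensive.

Import Order.TTheory GRing.Theory Num.Theory.
Import numFieldNormedType.Exports.

Local Open Scope classical_set_scope.
Local Open Scope complex_scope.
Local Open Scope ring_scope.

(** * Trace, determinant and spectrum of 2x2 matrices *)

Lemma det2E (F : comNzRingType) (A : 'M[F]_2) : \det A = A 0 0 * A 1 1 - A 0 1 * A 1 0.
Proof.
rewrite (expand_det_row _ 0) !big_ord_recl big_ord0 /cofactor !det_mx11 !mxE /=.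
rewrite addr0 expr0 expr1 mul1r mulN1r mulrN.
by congr (A _ _ * A _ _ - A _ _ * A _ _); apply/val_inj.
Qed.

Lemma mulmx2E (F : comNzRingType) n m (A : 'M[F]_(n, 2)) (B : 'M[F]_(2, m)) i j :
  (A *m B) i j = A i 0 * B 0 j + A i 1 * B 1 j.
Proof.
rewrite mxE !big_ord_recl big_ord0 addr0.
by congr (_ + A _ _ * B _ _); apply/val_inj.
Qed.

Lemma mxtrace2E (F : comNzRingType) (A : 'M[F]_2) : \tr A = A 0 0 + A 1 1.
Proof.
rewrite /mxtrace !big_ord_recl big_ord0 addr0.
by congr (_ + A _ _); apply/val_inj.
Qed.

Lemma char_poly2E (F : comNzRingType) (A : 'M[F]_2) :
  char_poly A = 'X^2 - (A 0 0 + A 1 1)%:P * 'X + (\det A)%:P.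
Proof.
rewrite /char_poly !det2E !mxE /= !polyCD !rmorphN /= !polyCM; ring.
Qed.

Lemma mx2P (T : Type) m (v w : 'M[T]_(2, m)) :
  (forall j, v 0 j = w 0 j /\ v 1 j = w 1 j) -> v = w.
Proof.
move=> vw; apply/matrixP => i j; have [h0 h1] := vw j.
case: i => [[|[|//]] hi].
  by rewrite (_ : Ordinal hi = 0) //; apply/val_inj.
by rewrite (_ : Ordinal hi = 1) //; apply/val_inj.
Qed.

Section RealMatrix2.
Variable R : realType.
Implicit Types u v : 'cV[R]_2.

Lemma vdot2E u v : vdot u v = u 0 0 * v 0 0 + u 1 0 * v 1 0.
Proof.
rewrite /vdot !big_ord_recl big_ord0 addr0.
by congr (_ + u _ _ * v _ _); apply/val_inj.
Qed.

Lemma eigenvalues2P (M : 'M[R[i]]_2) (x y : R[i]) :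
  M 0 0 + M 1 1 = x + y -> \det M = x * y -> eigenvalues2 M x y.
Proof.
move=> htr hdet.
have hp : char_poly M = ('X - x%:P) * ('X - y%:P).
  rewrite char_poly2E htr hdet polyCD polyCM; ring.
split=> // z; rewrite eigenvalue_root_char hp rootM !root_XsubC.
by split=> [/orP[]/eqP ->|[]->]; rewrite ?eqxx ?orbT //; [left|right].
Qed.

Lemma eigenvalue2E (A : 'M[R[i]]_2) (z : R[i]) :
  eigenvalue A z = (z ^+ 2 - (A 0 0 + A 1 1) * z + \det A == 0).
Proof. by rewrite eigenvalue_root_char char_poly2E /root !hornerE. Qed.

(* The two roots of the characteristic polynomial have real sum and product,
   so they are both real or conjugate. *)
Lemma stable_trace_det (A : 'M[R]_2) :
  (forall z : R[i], eigenvalue (mxC A) z -> complex.Re z < 0) ->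
  A 0 0 + A 1 1 < 0 /\ 0 < \det A.
Proof.
set t := A 0 0 + A 1 1; move=> hA.
have hev z : eigenvalue (mxC A) z = (z ^+ 2 - t%:C * z + (\det A)%:C == 0).
  rewrite eigenvalue2E /mxC det_map_mx !mxE.
  by rewrite -rmorphD.
(* [s ^+ 2] is a quarter of the discriminant, so the eigenvalues are [t / 2 + s] and [t / 2 - s]. *)
have [s s2] : exists s : R[i], s ^+ 2 = (t ^+ 2 / 4 - \det A)%:C.
  by exists (sqrtc (t ^+ 2 / 4 - \det A)%:C); rewrite sqr_sqrtc.
have hroot (w : R[i]) : w ^+ 2 = s ^+ 2 -> complex.Re ((t / 2)%:C + w) < 0.
  move=> hw; apply: hA; rewrite hev; apply/eqP.
  have -> : t%:C = 2 * (t / 2)%:C :> R[i].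
    rewrite -[2]/(2%:R) -(rmorph_nat (real_complex R)) -rmorphM /=; congr (_%:C).
    by field.
  have -> : (\det A)%:C = (t / 2)%:C ^+ 2 - s ^+ 2.
    rewrite s2 -rmorphXn -rmorphB /=; congr (_%:C).
    by field.
  rewrite -hw; ring.
have h1 := hroot s erefl.
have h2 : complex.Re ((t / 2)%:C - s) < 0 by apply: hroot; rewrite sqrrN.
case: s s2 {hroot} h1 h2 => a b; rewrite expr2 /= => -[hre him] h1 h2.
split; first by lra.
have : a * b = 0 by lra.
(* For [a = 0] the determinant is [t ^+ 2 / 4 + b ^+ 2]; for [b = 0] it is the product of the
   negative numbers [t / 2 + a] and [t / 2 - a]. *)
move/eqP; rewrite mulf_eq0 => /orP[]/eqP h0; rewrite h0 in hre h1 h2.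
  by nra.
by nra.
Qed.

End RealMatrix2.

(** Right kernel vector [(x, y)] and left kernel vector [(a, b)] with pairing 1 determine the matrix
    up to its trace [t = p + r]: it is [t] times the projection Id - [(x, y)^T (a, b)]. *)
Lemma singular2_entries (F : realDomainType) (p m n r x y a b : F) :
  p * x + m * y = 0 -> n * x + r * y = 0 ->
  p * a + n * b = 0 -> m * a + r * b = 0 -> x * a + y * b = 1 ->
  [/\ p = (p + r) * (1 - x * a), m = - (p + r) * x * b,
      n = - (p + r) * y * a & r = (p + r) * (1 - y * b)].
Proof.
move=> h1 h2 h3 h4 h5.
(* Once multiplied by suitable coordinates or entries, the hypotheses are linear in the monomials of
   the goals. *)
have f1 : x * (p * a + n * b) = 0 by rewrite h3 mulr0.
have f2 : b * (n * x + r * y) = 0 by rewrite h2 mulr0.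
have f3 : b * (p * x + m * y) = 0 by rewrite h1 mulr0.
have f4 : x * (m * a + r * b) = 0 by rewrite h4 mulr0.
have f5 : y * (p * a + n * b) = 0 by rewrite h3 mulr0.
have f6 : a * (n * x + r * y) = 0 by rewrite h2 mulr0.
have f7 : y * (m * a + r * b) = 0 by rewrite h4 mulr0.
have f8 : a * (p * x + m * y) = 0 by rewrite h1 mulr0.
have g z : z * (x * a + y * b) = z by rewrite h5 mulr1.
have gp := g p; have gm := g m; have gn := g n; have gr := g r.
split; lra.
Qed.

(** * Consequences of criticality and the sign of [rho_kappa] *)

Section Dispersion.
Variables (R : realType) (T : critical_data R).
Hypothesis hT : turing_instability T.
Local Notation kc := (kc T).
Local Notation d1 := (d1 T).
Local Notation d2 := (d2 T).
Local Notation L := (sysL T).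
Local Notation P := (Lcrit T).

Lemma kc_gt0 : 0 < kc. Proof. by case: hT. Qed.

Let k2_gt0 : 0 < kc ^+ 2. Proof. by rewrite exprn_gt0 // kc_gt0. Qed.

Lemma det_symbolE s :
  \det (- s *: sysD T + L) =
    d1 * d2 * s ^+ 2 - (d1 * L 1 1 + d2 * L 0 0) * s + \det L.
Proof. rewrite !det2E !mxE /=; ring. Qed.

Lemma disp0_det k l : disp0 T 0 k l = (\det (- (k ^+ 2 + l ^+ 2) *: sysD T + L))%:C.
Proof.
rewrite /disp0 /disp /Lhat mulr0 rmorph0 mulr0 !scale0r !addr0 -scalemx1 scale0r subr0.
by rewrite /mxC det_map_mx.
Qed.

Lemma det_symbol_eq0 s : 0 <= s ->
  \det (- s *: sysD T + L) = 0 <-> s = kc ^+ 2.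
Proof.
move=> s0; have [_ _ h _ _] := hT.
(* Any [s >= 0] is the squared length of the wave vector [(sqrt s, 0)]. *)
have := h 0 (Num.sqrt s) 0; rewrite disp0_det expr0n addr0 sqr_sqrtr //= lexx => -[h1 h2].
split=> hs; first by case: h1 => //; rewrite hs.
by case: h2 => // -[].
Qed.

(* The product of the roots of the quadratic [s |-> det (- s D + L)] is
   positive, so that both are positive, hence equal to [kc ^+ 2]. *)
Lemma det_symbol_double_root :
  \det L = d1 * d2 * kc ^+ 2 ^+ 2 /\
  d1 * L 1 1 + d2 * L 0 0 = 2 * d1 * d2 * kc ^+ 2.
Proof.
have [_ hs _ _ _] := hT; have [_ dL] := stable_trace_det hs.
have p1 := d1_gt0 T; have p2 := d2_gt0 T; have p := k2_gt0.
have /(det_symbol_eq0 (ltW p)) := erefl (kc ^+ 2); rewrite det_symbolE.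
move: (\det L) (d1 * L 1 1 + d2 * L 0 0) (kc ^+ 2) dL p (@det_symbol_eq0) (det_symbolE).
move=> dt g k dL p hf fE h.
have c0 : 0 < d1 * d2 * k by rewrite !mulr_gt0.
have gE : g = d1 * d2 * k + dt / k.
  apply: (mulIf (lt0r_neq0 p)); rewrite mulrDl divfK ?gt_eqF //; lra.
(* By Vieta, this quotient is the root other than [k]. *)
have /hf : 0 <= dt / (d1 * d2 * k) by rewrite divr_ge0 // ltW.
rewrite fE => -[h0 _].
have : dt / (d1 * d2 * k) = k.
  by apply: h0; rewrite gE; field; rewrite !gt_eqF.
move/(canRL (divfK (lt0r_neq0 c0))) => dE; split; first by rewrite dE; ring.
by rewrite gE dE; field; rewrite gt_eqF.
Qed.

Lemma trace_Lcrit_lt0 : \tr P < 0.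
Proof.
have [_ hs _ _ _] := hT; have [hL _] := stable_trace_det hs.
have p1 := d1_gt0 T; have p2 := d2_gt0 T; have p := k2_gt0.
have -> : \tr P = L 0 0 + L 1 1 - kc ^+ 2 * (d1 + d2).
  by rewrite mxtrace2E !mxE /=; ring.
have : 0 < kc ^+ 2 * (d1 + d2) by rewrite mulr_gt0 // addr_gt0.
lra.
Qed.

Hypothesis hE : critical_vectors T.
Local Notation E0 := (E0 T).
Local Notation E0s := (E0s T).

Lemma Lcrit_entries :
  [/\ P 0 0 = \tr P * (1 - E0 0 0 * E0s 0 0), P 0 1 = - \tr P * E0 0 0 * E0s 1 0,
      P 1 0 = - \tr P * E0 1 0 * E0s 0 0 & P 1 1 = \tr P * (1 - E0 1 0 * E0s 1 0)].
Proof.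
have [/(_ E0) h1 /(_ E0s) h2 _ h3] := hE.
have /h1 hP : exists s, E0 = s *: E0 by exists 1; rewrite scale1r.
have /h2 hPt : exists s, E0s = s *: E0s by exists 1; rewrite scale1r.
have e A (v : 'cV[R]_2) i : A *m v = 0 -> A i 0 * v 0 0 + A i 1 * v 1 0 = 0.
  by move=> Av; rewrite -mulmx2E Av mxE.
rewrite mxtrace2E; rewrite vdot2E in h3.
have a0 := e _ _ _ 0 hP; have a1 := e _ _ _ 1 hP.
have := e _ _ _ 0 hPt; have := e _ _ _ 1 hPt; rewrite ![P^T _ _]mxE => b1 b0.
exact: (singular2_entries a0 a1 b0 b1 h3).
Qed.

(* A singular 2x2 matrix acts on the complement of its kernel as its trace. *)
Lemma Lcrit_mul v : P *m v = \tr P *: (v - vdot v E0s *: E0).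
Proof.
have [h00 h01 h10 h11] := Lcrit_entries.
apply: mx2P => j; rewrite !ord1 !mulmx2E h00 h01 h10 h11 !mxE vdot2E.
by split; ring.
Qed.

Lemma Lcrit_inv_eq w : vdot w E0s = 0 -> Lcrit_inv T w = (\tr P)^-1 *: w.
Proof.
move=> hw; have t0 : \tr P != 0 by rewrite lt_eqF // trace_Lcrit_lt0.
have wE : vdot ((\tr P)^-1 *: w) E0s = 0.
  by rewrite vdot2E !mxE -!mulrA -mulrDr -vdot2E hw mulr0.
(* On the kernel of the pairing with [E0s], [P] is multiplication by [\tr P], which is nonzero;
   hence the preimage is unique. *)
apply: xget_unique => [|v [h1 h2]].
  by split=> //; rewrite Lcrit_mul wE scale0r subr0 scalerA mulfV // scale1r.
by rewrite -h1 Lcrit_mul h2 scale0r subr0 scalerA mulVf // scale1r.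
Qed.

(* The solvability condition expresses that [det (- s D + L)] has vanishing
   derivative at [s = kc ^+ 2]. *)
Lemma vdot_D_critical : vdot (sysD T *m E0) E0s = 0.
Proof.
have t0 : \tr P != 0 by rewrite lt_eqF // trace_Lcrit_lt0.
have [_ hsum] := det_symbol_double_root.
have [h00 _ _ h11] := Lcrit_entries.
have e00 : P 0 0 = L 0 0 - kc ^+ 2 * d1 by rewrite !mxE /=; ring.
have e11 : P 1 1 = L 1 1 - kc ^+ 2 * d2 by rewrite !mxE /=; ring.
apply: (mulfI t0); rewrite mulr0 vdot2E !mulmx2E !mxE /= !mul0r addr0 add0r.
(* The diagonal of [P] gives the products of coordinates of [E0] and [E0s]; what remains is
   [d1 * P 1 1 + d2 * P 0 0], zero by the double root. *)
have -> : \tr P * (d1 * E0 0 0 * E0s 0 0 + d2 * E0 1 0 * E0s 1 0) =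
  d1 * (\tr P - P 0 0) + d2 * (\tr P - P 1 1) by rewrite h00 h11; ring.
rewrite mxtrace2E e00 e11; move: hsum => /eqP; rewrite -subr_eq0 => /eqP <-; ring.
Qed.

Lemma rho_kappaE : rho_kappa T = 4 * kc ^+ 2 * d1 * d2 / \tr P.
Proof.
have t0 : \tr P != 0 by rewrite lt_eqF // trace_Lcrit_lt0.
have [_ _ _] := hE; have := vdot_D_critical.
rewrite /rho_kappa /wAkappa (Lcrit_inv_eq vdot_D_critical).
have zE a (v : 'cV[R]_2) i : (a *: v) i 0 = a * v i 0 by rewrite mxE.
rewrite -!scalemxAr !vdot2E !zE !mulmx2E !mxE /= !mul0r !addr0 !add0r.
move: (\tr P) t0 => t t0 hD h3.
set X := E0 0 0 * E0s 0 0 in h3; set Y := E0 1 0 * E0s 1 0 in h3.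
have {}hD : d1 * X + d2 * Y = 0 by rewrite !mulrA.
have hD2 : d1 ^+ 2 * X + d2 ^+ 2 * Y = - (d1 * d2).
  (* Cayley-Hamilton for [D], paired between [E0] and [E0s]; [X + Y = 1] is the normalisation. *)
  have -> : d1 ^+ 2 * X + d2 ^+ 2 * Y =
    (d1 + d2) * (d1 * X + d2 * Y) - d1 * d2 * (X + Y) by ring.
  by rewrite hD h3 mulr0 sub0r mulr1.
transitivity (- (4 * kc ^+ 2) * (d1 ^+ 2 * X + d2 ^+ 2 * Y) / t).
  by rewrite /X /Y; field.
by rewrite hD2; field.
Qed.

Lemma rho_kappa_lt0 : rho_kappa T < 0.
Proof.
rewrite rho_kappaE pmulr_rlt0 ?invr_lt0 ?trace_Lcrit_lt0 //.
by do !apply: mulr_gt0; rewrite ?d1_gt0 ?d2_gt0 ?kc_gt0.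
Qed.

End Dispersion.

(** * Eigenvalues of the blocks and the shape of [omega'] *)

Section Blocks.
Variables (R : realType) (T : critical_data R).

Definition block_eigenvalue (sg e A lam : R) (p : R[i]) : R :=
  e ^+ 2 * (lam + A ^+ 2 * Defs.eta T + sg * (A * complex.Re `|offdiag T e p|)).

Lemma block_eigenvalues (e A lam : R) (p : R[i]) :
  eigenvalues2 (block T e A lam p)
    (block_eigenvalue 1 e A lam p)%:C (block_eigenvalue (- 1) e A lam p)%:C.
Proof.
rewrite /block_eigenvalue; set m := complex.Re _.
have mE : m%:C = `|offdiag T e p| by rewrite /m normc_def.
(* Since [2 * q / e] is real, the two off-diagonal factors are conjugate. *)
have zE : offdiag T e p * offdiag T e (p^*)%C = m%:C ^+ 2.
  rewrite mE sqr_normc; congr (_ * _).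
  by rewrite /offdiag rmorphD /= oppr0.
apply: eigenvalues2P.
  by rewrite !mxE /= -!rmorphM -!rmorphD /=; congr (_%:C); ring.
rewrite det2E !mxE /=.
move: (lam + _) (offdiag T e p) (offdiag T e (p^*)%C) zE {mE} => s z z' zE.
transitivity ((e ^+ 2 * s)%:C ^+ 2 - (e ^+ 2 * A)%:C ^+ 2 * (z * z')).
  rewrite (rmorphM _ (e ^+ 2) s) (rmorphM _ (e ^+ 2) A) /=; ring.
by rewrite zE -!rmorphXn -!rmorphM -rmorphB /=; congr (_%:C); ring.
Qed.

(** The hypothesis is lambda' with [al] eliminated by the bifurcation equation. Then [eta - rho_nl]
    is [3 * k0 - q2 + 8 * q1], and 1/4 - 1 yields the factor -3/4 of [rho_beta]. *)
Lemma block_eigenvalue_lead (sg e be ka A lam w rA r : R) (p : R[i]) :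
  lam = - (rho_beta T * be ^+ 2 + rho_kappa T * ka ^+ 2 + rho_nl T * A ^+ 2 + rA) +
        rho_beta T / 4 * be ^+ 2 + (rho_kappa T * ka ^+ 2 + w) + r ->
  block_eigenvalue sg e A lam p -
    lead T sg e be A w (complex.Re `|offdiag T e p|) = e ^+ 2 * (r - rA).
Proof.
move=> ->; rewrite /block_eigenvalue /lead /Defs.eta /rho_nl.
by field.
Qed.

(** Completing the square in [l] exposes the critical point [- k / 3] and the value there. *)
Lemma omega'_sq (k l : R) :
  omega' T k l = - rho_kappa T * (k ^+ 2 - 9 / 16 * (l + k / 3) ^+ 2).
Proof. by rewrite /omega'; field. Qed.

Lemma omega'_max (k l : R) : rho_kappa T < 0 -> l != - k / 3 ->
  omega' T k l < omega' T k (- k / 3).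
Proof.
move=> hr hl; rewrite !omega'_sq ltr_pM2l ?oppr_gt0 //.
have : 0 < (l + k / 3) ^+ 2 by rewrite exprn_even_gt0 //= addr_eq0 -mulNr.
rewrite mulNr addNr expr0n /=; lra.
Qed.

Lemma p_qh_diag (be ka : R) : p_qh T be ka ka = p_hex T be ka.
Proof.
have vD (z z' : 'cV[R[i]]_2) v : vdotC (z + z') v = vdotC z v + vdotC z' v.
  by rewrite /vdotC -big_split; apply: eq_bigr => i _; rewrite mxE mulrDl.
rewrite /p_qh /p_hex vD.
have -> : 5 / 2 * ka + 3 / 2 * ka = 4 * ka by field.
have -> : (ka + 3 * ka) * kc T = 4 * ka * kc T by ring.
congr (_ + vdotC _ _).
by rewrite opprD addrC /mxC scaleNr [map_mx _ (- _)]raddfN.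
Qed.

End Blocks.

(** * Error estimates *)

Section BigO.
Variable R : realType.

Lemma bigO_sqr_mulB (f r s : R -> R) :
  r =O_ (0^'+) (fun e => e) -> s =O_ (0^'+) (fun e => e) ->
  (\forall e \near 0^'+, f e = e ^+ 2 * (r e - s e)) ->
  f =O_ (0^'+) (fun e => e ^+ 3).
Proof.
move=> /eqO_exP[c c0 hr] /eqO_exP[d d0 hs] hf.
apply/eqO_exP; exists (c + d); first exact: addr_gt0.
near=> e.
have -> : f e = e ^+ 2 * (r e - s e) by near: e.
have h1 : `|r e| <= c * `|e| by near: e.
have h2 : `|s e| <= d * `|e| by near: e.
rewrite (exprSr e 2) (normrM _ (r e - s e)) (normrM (e ^+ 2) e) mulrCA ler_wpM2l //.
by rewrite (le_trans (ler_normB _ _)) // mulrDl lerD.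
Unshelve. all: by end_near. Qed.

(** The difference equals [s e / (a e + sqrt (b e))], whose denominator is at least [sqrt d]. *)
Lemma bigO_sqrt (a b s : R -> R) (d : R) : 0 < d ->
  (\forall e \near 0^'+, [/\ 0 < a e, d <= b e & a e ^+ 2 = b e + s e]) ->
  s =O_ (0^'+) (fun e => e) ->
  (fun e => a e - Num.sqrt (b e)) =O_ (0^'+) (fun e => e).
Proof.
move=> d0 hab /eqO_exP[c c0 hs].
have sd0 : 0 < Num.sqrt d by rewrite sqrtr_gt0.
apply/eqO_exP; exists (c / Num.sqrt d); first exact: divr_gt0.
near=> e.
have [a0 db ab] : [/\ 0 < a e, d <= b e & a e ^+ 2 = b e + s e] by near: e.
have hse : `|s e| <= c * `|e| by near: e.
have b0 : 0 < b e by exact: lt_le_trans db.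
have dsb : Num.sqrt d <= Num.sqrt (b e) by rewrite ler_wsqrtr.
rewrite mulrAC ler_pdivlMr //; apply: le_trans hse.
have -> : s e = (a e - Num.sqrt (b e)) * (a e + Num.sqrt (b e)).
  by rewrite -subr_sqr sqr_sqrtr ?ltW // ab addrC addKr.
rewrite normrM ler_wpM2l // ger0_norm; last by rewrite addr_ge0 ?sqrtr_ge0 ?ltW.
by rewrite (le_trans dsb) // lerDr ltW.
Unshelve. all: by end_near. Qed.

End BigO.

(** * Combination with the bifurcation equation of the stripes *)

Theorem lemma3p15 (R : realType) (T : critical_data R)
    (al be ka A ac c x0 : R -> R) (phi : R -> R -> 'cV[R]_2)
    (hT : turing_instability T) (hE : critical_vectors T)
    (hnl : rho_nl T < 0)
    (hst : stripe_family T al be ka A ac c x0 phi) :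
  [/\ (* eigenvalues on the quasi-hexagonal domain *)
      forall l r : R -> R,
        bounded_near l 0^'+ -> (\forall e \near 0^'+, l e != ka e) ->
        r =O_ (0^'+) (fun e => e) ->
        exists lp lm : R -> R,
          [/\ \forall e \near 0^'+,
                eigenvalues2 (L2qh T e (al e) (be e) (ka e) (l e) (A e) (r e))
                             (lp e)%:C (lm e)%:C,
              (fun e => lp e - lead_qh T 1 e (be e) (ka e) (l e) (A e))
                =O_ (0^'+) (fun e => e ^+ 3) &
              (fun e => lm e - lead_qh T (-1) e (be e) (ka e) (l e) (A e))
                =O_ (0^'+) (fun e => e ^+ 3)],
      (* amplitude, away from the bifurcation point of the stripes *)
      (exists2 delta : R, 0 < delta &
         \forall e \near 0^'+, delta <= amplitude_sq T (al e) (be e) (ka e)) ->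
      (fun e => A e - Num.sqrt (amplitude_sq T (al e) (be e) (ka e)))
        =O_ (0^'+) (fun e => e),
      (* the most unstable perturbation *)
      forall e kt : R, 0 < e ->
        [/\ forall lt : R, lt != - kt / 3 ->
              omega T e kt lt < omega T e kt (- kt / 3) /\
              (forall sg b a m : R,
                 lead T sg e b a (omega' T (kt / e) (lt / e)) m <
                 lead T sg e b a (omega' T (kt / e) (- kt / 3 / e)) m),
            omega T e kt (- kt / 3) = - rho_kappa T * kt ^+ 2 &
            0 <= - rho_kappa T * kt ^+ 2] &
      (* the exactly hexagonal case *)
      [/\ forall e kt : R, omega T e kt kt = 0,
          forall sg e b k a : R,
            lead_qh T sg e b k k a = lead_hex T sg e b k a &
          forall r rh : R -> R,
            r =O_ (0^'+) (fun e => e) -> rh =O_ (0^'+) (fun e => e) ->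
            exists lp lm hp hm : R -> R,
              [/\ \forall e \near 0^'+,
                    [/\ eigenvalues2
                          (L2qh T e (al e) (be e) (ka e) (ka e) (A e) (r e))
                          (lp e)%:C (lm e)%:C,
                        eigenvalues2
                          (L2hex T e (al e) (be e) (ka e) (A e) (rh e))
                          (hp e)%:C (hm e)%:C &
                        r e = rh e -> lp e = hp e /\ lm e = hm e],
                  (fun e => lp e - hp e) =O_ (0^'+) (fun e => e ^+ 3),
                  (fun e => lm e - hm e) =O_ (0^'+) (fun e => e ^+ 3),
                  (fun e => hp e - lead_hex T 1 e (be e) (ka e) (A e))
                    =O_ (0^'+) (fun e => e ^+ 3) &
                  (fun e => hm e - lead_hex T (-1) e (be e) (ka e) (A e))
                    =O_ (0^'+) (fun e => e ^+ 3)]]].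
Proof.
have hrk := rho_kappa_lt0 hT hE.
have [_ _ hnear _ [rA hrA hbif]] := hst.
have hal : \forall e \near 0^'+, 0 < A e /\ al e =
    - (rho_beta T * be e ^+ 2 + rho_kappa T * ka e ^+ 2 + rho_nl T * A e ^+ 2 + rA e).
  near=> e.
  have e0 : 0 < e by near: e; exact: nbhs_right_gt.
  have [A0 _ _] : [/\ 0 < A e, (e ^+ 2 * al e)%:C = lambdaM T * (ac e)%:C &
    is_stripe T (ac e) (e * be e) (c e) (kc T + e * ka e) (phi e)] by near: e.
  have : e ^+ 2 * (al e + rho_beta T * be e ^+ 2 + rho_kappa T * ka e ^+ 2 +
    rho_nl T * A e ^+ 2 + rA e) = 0 by near: e.
  move=> /eqP; rewrite mulf_eq0 sqrf_eq0 gt_eqF //= => /eqP h.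
  by split=> //; lra.
(* Quantifying over [l] and [s] after the filter lets one estimate serve both the quasi-hexagonal
   case and [l = ka e]. *)
have hlead : \forall e \near 0^'+, forall sg l s,
    block_eigenvalue T sg e (A e) (al e + rho_beta T / 4 * be e ^+ 2 +
        rho_kappa T / 16 * (ka e + 3 * l) ^+ 2 + s) (p_qh T (be e) (ka e) l) -
      lead_qh T sg e (be e) (ka e) l (A e) = e ^+ 2 * (s - rA e).
  apply: filterS hal => e [_ hale] sg l s.
  apply: (@block_eigenvalue_lead _ T sg e (be e) (ka e) (A e) _
    (omega' T (ka e) l) (rA e) s).
  (* [omega'] is [rho_kappa] times [(ka + 3 * l) ^+ 2 / 16 - ka ^+ 2]. *)
  by rewrite hale /omega'; field.
have omegaE e k l : 0 < e -> omega T e k l = omega' T k l.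
  by move=> e0; rewrite /omega /omega'; field; rewrite gt_eqF.
split.
- move=> l r _ _ hr.
  pose ev sg e := block_eigenvalue T sg e (A e) (al e + rho_beta T / 4 * be e ^+ 2 +
    rho_kappa T / 16 * (ka e + 3 * l e) ^+ 2 + r e) (p_qh T (be e) (ka e) (l e)).
  exists (ev 1), (ev (-1)); split.
  + by apply: filterE => e; exact: block_eigenvalues.
  + by apply: (bigO_sqr_mulB hr hrA); apply: filterS hlead => e; exact.
  + by apply: (bigO_sqr_mulB hr hrA); apply: filterS hlead => e; exact.
- move=> [d d0 hd].
  (* Solved for [A e ^+ 2], the bifurcation equation gives [amplitude_sq] with remainder
     [- rA e / rho_nl]. *)
  apply: (@bigO_sqrt _ A _ (fun e => - (rho_nl T)^-1 * rA e) _ d0).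
    near=> e.
    have [A0 hale] : 0 < A e /\ al e = - (rho_beta T * be e ^+ 2 +
      rho_kappa T * ka e ^+ 2 + rho_nl T * A e ^+ 2 + rA e) by near: e.
    split=> //; first by near: e.
    by rewrite /amplitude_sq hale; field; rewrite lt_eqF.
  move/eqO_exP: hrA => [C C0 hC]; apply/eqO_exP.
  exists (`|(rho_nl T)^-1| * C); first by rewrite mulr_gt0 ?normr_gt0 ?invr_eq0 ?lt_eqF.
  by apply: filterS hC => e he; rewrite normrM normrN -mulrA ler_wpM2l.
- move=> e kt e0.
  have kE : - kt / 3 / e = - (kt / e) / 3 by field; rewrite gt_eqF.
  split.
  + move=> lt hlt; split; first by rewrite !omegaE // omega'_max.
    move=> sg b a m; rewrite /lead ltr_pM2l ?exprn_gt0 // ltrD2r ltrD2l kE.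
    apply: omega'_max => //; rewrite -kE; apply: contra hlt.
    by move=> /eqP /(divIf (lt0r_neq0 e0)) ->.
  + by rewrite omegaE // omega'_sq; field.
  + by rewrite mulr_ge0 ?sqr_ge0 // oppr_ge0 ltW.
- have lamE (k : R) : rho_kappa T / 16 * (k + 3 * k) ^+ 2 = rho_kappa T * k ^+ 2 by field.
  have leadE sg e b k a : lead_qh T sg e b k k a = lead_hex T sg e b k a.
    by rewrite /lead_qh /lead_hex p_qh_diag /omega' subrr mulr0 !mul0r.
  split=> [e kt||r rh hr hrh] //; first by rewrite /omega /omega' subrr mulr0 !mul0r mulr0.
  (* At [l = ka] the two blocks differ only in the remainder [s], which is [r] or [rh]. *)
  pose ev sg (s : R -> R) e := block_eigenvalue T sg e (A e) (al e +
    rho_beta T / 4 * be e ^+ 2 + rho_kappa T * ka e ^+ 2 + s e) (p_hex T (be e) (ka e)).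
  have evB sg : (fun e => ev sg r e - ev sg rh e) =O_ (0^'+) (fun e => e ^+ 3).
    apply: (bigO_sqr_mulB hr hrh); apply: filterE => e.
    by rewrite /ev /block_eigenvalue; ring.
  have evlead sg : (fun e => ev sg rh e - lead_hex T sg e (be e) (ka e) (A e))
      =O_ (0^'+) (fun e => e ^+ 3).
    apply: (bigO_sqr_mulB hrh hrA); apply: filterS hlead => e.
    by move=> /(_ sg (ka e) (rh e)); rewrite lamE p_qh_diag leadE.
  exists (ev 1 r), (ev (-1) r), (ev 1 rh), (ev (-1) rh); split=> //.
  apply: filterE => e; split; last by rewrite /ev => ->.
    by rewrite /L2qh lamE p_qh_diag; exact: block_eigenvalues.
  exact: block_eigenvalues.
Unshelve. all: by end_near. Qed.
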